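(* Let $N_x,N_y\ge 1$ be integers, let $\Delta x,\Delta y>0$, $\Delta=\sqrt{\Delta x^2+\Delta y^2}/\sqrt2$ and $\alpha>0$. Let $p_{i,j}(t),u_{i,j}(t),v_{i,j}(t)$, with $(i,j)\in(\mathbb Z/N_x\mathbb Z)\times(\mathbb Z/N_y\mathbb Z)$ (periodic boundary conditions), be a solution of the semi-discrete scheme $$ \begin{aligned} \frac{\mathrm d}{\mathrm dt}p+\bar D_x u+\bar D_y v&=\frac{\alpha\Delta}{2}\left(\bar D_{xx}p+\bar D_{yy}p\right),\\ \frac{\mathrm d}{\mathrm dt}u+\bar D_x p&=\frac{\alpha\Delta}{2}\left(\bar D_{xx}u+D_{xy}v\right),\\ \frac{\mathrm d}{\mathrm dt}v+\bar D_y p&=\frac{\alpha\Delta}{2}\left(D_{xy}u+\bar D_{yy}v\right), \end{aligned} $$ where $\bar D_x,\bar D_y,\bar D_{xx},\bar D_{yy},D_{xy}$ are the finite difference operators given in the context. Set $$\mathcal E_{i,j}=\frac{u_{i,j}^2+v_{i,j}^2}{2}+\frac{p_{i,j}^2}{2}.$$ Then the semi-discrete energy inequality $$\frac{\mathrm d}{\mathrm dt}\sum_{i,j}\mathcal E_{i,j}\le 0$$ holds.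
   Context: The scheme is the stationarity preserving (global flux) finite volume discretization, with streamline-upwind corner dissipation, of the linear acoustic system $\partial_t u+\partial_x p=0$, $\partial_t v+\partial_y p=0$, $\partial_t p+\partial_x u+\partial_y v=0$, on a uniform Cartesian grid with cell sizes $\Delta x,\Delta y$ and periodic boundary conditions. For a grid function $a=(a_{i,j})$ (indices understood periodically), the operators are $$(\bar D_x a)_{i,j}=\frac{1}{\Delta x}\left[\tfrac18(a_{i+1,j+1}-a_{i-1,j+1})+\tfrac14(a_{i+1,j}-a_{i-1,j})+\tfrac18(a_{i+1,j-1}-a_{i-1,j-1})\right],$$ $$(\bar D_{xx}a)_{i,j}=\frac{1}{\Delta x^2}\left[\tfrac14(a_{i+1,j+1}-2a_{i,j+1}+a_{i-1,j+1})+\tfrac12(a_{i+1,j}-2a_{i,j}+a_{i-1,j})+\tfrac14(a_{i+1,j-1}-2a_{i,j-1}+a_{i-1,j-1})\right],$$ $$(D_{xy}a)_{i,j}=\frac{1}{4\Delta x\Delta y}\left[a_{i+1,j+1}-a_{i-1,j+1}-a_{i+1,j-1}+a_{i-1,j-1}\right],$$ and $\bar D_y$, $\bar D_{yy}$ are obtained from $\bar D_x$, $\bar D_{xx}$ by exchanging the roles of the two directions (i.e. of $i$ and $j$, and of $\Delta x$ and $\Delta y$). *)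

(* Defs.v *)
From mathcomp Require Import all_boot all_order all_algebra.
From mathcomp Require Import all_classical all_reals all_analysis.

Set Implicit Arguments.
Unset Strict Implicit.
Unset Printing Implicit Defensive.

Import Order.TTheory GRing.Theory Num.Theory.
Import numFieldNormedType.Exports.

Local Open Scope ring_scope.

(* [a i j] is the value in the cell (i, j) of Z/Nx x Z/Ny.  The index sets are
   ordinals, not 'Z_Nx and 'Z_Ny, which would be wrong for one cell; [ordS] and
   [ord_pred] are the cyclic i + 1 and i - 1. *)
Definition grid (R : realType) (Nx Ny : nat) : Type := 'I_Nx -> 'I_Ny -> R.

Definition grid_tr (R : realType) (Nx Ny : nat) (a : grid R Nx Ny) :
    grid R Ny Nx :=
  fun j i => a i j.

Definition Dbar_x (R : realType) (Nx Ny : nat) (dx : R) (a : grid R Nx Ny) :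
    grid R Nx Ny :=
  fun i j =>
    dx^-1 *
      (8^-1 * (a (ordS i) (ordS j) - a (ord_pred i) (ordS j))
       + 4^-1 * (a (ordS i) j - a (ord_pred i) j)
       + 8^-1 * (a (ordS i) (ord_pred j) - a (ord_pred i) (ord_pred j))).

Definition Dbar_xx (R : realType) (Nx Ny : nat) (dx : R) (a : grid R Nx Ny) :
    grid R Nx Ny :=
  fun i j =>
    (dx ^+ 2)^-1 *
      (4^-1 * (a (ordS i) (ordS j) - 2 * a i (ordS j)
               + a (ord_pred i) (ordS j))
       + 2^-1 * (a (ordS i) j - 2 * a i j + a (ord_pred i) j)
       + 4^-1 * (a (ordS i) (ord_pred j) - 2 * a i (ord_pred j)
                 + a (ord_pred i) (ord_pred j))).

Definition D_xy (R : realType) (Nx Ny : nat) (dx dy : R) (a : grid R Nx Ny) :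
    grid R Nx Ny :=
  fun i j =>
    (4 * dx * dy)^-1 *
      (a (ordS i) (ordS j) - a (ord_pred i) (ordS j)
       - a (ordS i) (ord_pred j) + a (ord_pred i) (ord_pred j)).

Definition Dbar_y (R : realType) (Nx Ny : nat) (dy : R) (a : grid R Nx Ny) :
    grid R Nx Ny :=
  grid_tr (Dbar_x dy (grid_tr a)).

Definition Dbar_yy (R : realType) (Nx Ny : nat) (dy : R) (a : grid R Nx Ny) :
    grid R Nx Ny :=
  grid_tr (Dbar_xx dy (grid_tr a)).

Definition mesh_size (R : realType) (dx dy : R) : R :=
  Num.sqrt (dx ^+ 2 + dy ^+ 2) / Num.sqrt 2.

(* [derive1] has a junk value where a function is not differentiable, hence the
   explicit differentiability requirements. *)
Definition is_scheme_solution (R : realType) (Nx Ny : nat) (dx dy alpha : R)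
    (J : set R) (p u v : R -> grid R Nx Ny) : Prop :=
  let c := alpha * mesh_size dx dy / 2 in
  forall t : R, J t -> forall (i : 'I_Nx) (j : 'I_Ny),
  [/\ [/\ derivable (fun s => p s i j) t 1,
          derivable (fun s => u s i j) t 1 &
          derivable (fun s => v s i j) t 1],
      derive1 (fun s => p s i j) t + Dbar_x dx (u t) i j + Dbar_y dy (v t) i j
        = c * (Dbar_xx dx (p t) i j + Dbar_yy dy (p t) i j),
      derive1 (fun s => u s i j) t + Dbar_x dx (p t) i j
        = c * (Dbar_xx dx (u t) i j + D_xy dx dy (v t) i j) &
      derive1 (fun s => v s i j) t + Dbar_y dy (p t) i j
        = c * (D_xy dx dy (u t) i j + Dbar_yy dy (v t) i j)].

Definition energy (R : realType) (Nx Ny : nat) (p u v : grid R Nx Ny) :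
    grid R Nx Ny :=
  fun i j => (u i j ^+ 2 + v i j ^+ 2) / 2 + p i j ^+ 2 / 2.

(* Main.v *)
(** On the cell corners (i+1/2, j+1/2) let [G_x], [G_y], [A] be the difference
    quotients and the mean of the four neighbouring cell values.  For the scalar
    product obtained by summing over the periodic grid, summation by parts gives
    [Dbar_x = - G_x^* A = A^* G_x], [Dbar_xx = - G_x^* G_x],
    [D_xy = - G_x^* G_y = - G_y^* G_x] and [Dbar_yy = - G_y^* G_y].  Hence
    [Dbar_x] and [Dbar_y] are skew and drop out of the energy balance, which
    leaves
    [dE/dt = - c (|G_x p|^2 + |G_y p|^2 + |G_x u + G_y v|^2)]. *)

Require Import Defs.
From mathcomp Require Import all_boot all_order all_algebra.
From mathcomp Require Import all_classical all_reals all_analysis.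
From mathcomp Require Import ring lra.

Import Order.TTheory GRing.Theory Num.Theory.
Import numFieldNormedType.Exports.

Local Open Scope ring_scope.

Definition inner {R : realType} {Nx Ny : nat} (a b : grid R Nx Ny) : R :=
  \sum_(i < Nx) \sum_(j < Ny) a i j * b i j.

(* Entry (i, j) lives on the corner (i+1/2, j+1/2). *)
Definition corner {R : realType} {Nx Ny : nat} (w00 w10 w01 w11 : R)
    (a : grid R Nx Ny) : grid R Nx Ny :=
  fun i j => w00 * a i j + w10 * a (ordS i) j
             + w01 * a i (ordS j) + w11 * a (ordS i) (ordS j).

(** Transpose of [corner] for [inner], with the same weights: corner values go back to the cells, so
    every shift is reversed. *)
Definition corner_adj {R : realType} {Nx Ny : nat} (w00 w10 w01 w11 : R)
    (b : grid R Nx Ny) : grid R Nx Ny :=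
  fun i j => w00 * b i j + w10 * b (ord_pred i) j
             + w01 * b i (ord_pred j) + w11 * b (ord_pred i) (ord_pred j).

(** Mean of the difference quotients in rows j and j+1, whence the factor 1/2. *)
Definition corner_grad_x {R : realType} {Nx Ny : nat} (dx : R) :
    grid R Nx Ny -> grid R Nx Ny :=
  corner (- (2 * dx)^-1) (2 * dx)^-1 (- (2 * dx)^-1) (2 * dx)^-1.

Definition corner_grad_y {R : realType} {Nx Ny : nat} (dy : R) :
    grid R Nx Ny -> grid R Nx Ny :=
  corner (- (2 * dy)^-1) (- (2 * dy)^-1) (2 * dy)^-1 (2 * dy)^-1.

Definition corner_avg {R : realType} {Nx Ny : nat} :
    grid R Nx Ny -> grid R Nx Ny :=
  corner 4^-1 4^-1 4^-1 4^-1.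

Section SummationByParts.
Context {R : realType} {Nx Ny : nat}.
Implicit Types a b : grid R Nx Ny.

Lemma innerC a b : inner a b = inner b a.
Proof. by apply: eq_bigr => i _; apply: eq_bigr => j _; rewrite mulrC. Qed.

Lemma eq_innerr a b b' :
  (forall i j, b i j = b' i j) -> inner a b = inner a b'.
Proof.
by move=> eb; apply: eq_bigr => i _; apply: eq_bigr => j _; rewrite eb.
Qed.

Lemma innerDl a a' b :
  inner (fun i j => a i j + a' i j) b = inner a b + inner a' b.
Proof.
rewrite /inner -big_split; apply: eq_bigr => i _ /=.
by rewrite -big_split; apply: eq_bigr => j _ /=; rewrite mulrDl.
Qed.

Lemma innerZl (k : R) a b : inner (fun i j => k * a i j) b = k * inner a b.
Proof.
rewrite /inner mulr_sumr; apply: eq_bigr => i _.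
by rewrite mulr_sumr; apply: eq_bigr => j _; rewrite mulrA.
Qed.

Lemma innerDr a b b' :
  inner a (fun i j => b i j + b' i j) = inner a b + inner a b'.
Proof. by rewrite innerC innerDl !(innerC a). Qed.

Lemma innerZr (k : R) a b : inner a (fun i j => k * b i j) = k * inner a b.
Proof. by rewrite innerC innerZl (innerC a). Qed.

Lemma inner_ge0 a : 0 <= inner a a.
Proof.
by apply: sumr_ge0 => i _; apply: sumr_ge0 => j _; rewrite -expr2 sqr_ge0.
Qed.

(** This is |a + b|^2, expanded to match the cross terms of the velocity dissipation. *)
Lemma inner_sqrD_ge0 a b : 0 <= inner a a + 2 * inner a b + inner b b.
Proof.
have := inner_ge0 (fun i j => a i j + b i j).
rewrite innerDl !innerDr (innerC b a); lra.
Qed.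

(** Periodicity makes the cyclic shifts bijective, so for them this is summation by parts without
    boundary terms. *)
Lemma inner_reindex (f f' : 'I_Nx -> 'I_Nx) (g g' : 'I_Ny -> 'I_Ny) a b :
  cancel f f' -> cancel f' f -> cancel g g' -> cancel g' g ->
  inner (fun i j => a (f i) (g j)) b = inner a (fun i j => b (f' i) (g' j)).
Proof.
move=> fK f'K gK g'K; rewrite /inner (reindex f' (onW_bij _ (Bijective f'K fK))).
apply: eq_bigr => i _; rewrite (reindex g' (onW_bij _ (Bijective g'K gK))).
by apply: eq_bigr => j _; rewrite f'K g'K.
Qed.

Lemma inner_corner (w00 w10 w01 w11 : R) a b :
  inner (corner w00 w10 w01 w11 a) b = inner a (corner_adj w00 w10 w01 w11 b).
Proof.
rewrite /corner /corner_adj !innerDl !innerDr !innerZl !innerZr.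
have idK n : cancel (@id 'I_n) id by [].
have SK := @ordSK; have PK := @ord_predK.
(* One shift per weight: in i, in j, in both; [w00] carries none. *)
rewrite (@inner_reindex (@ordS _) (@ord_pred _) id id)//.
rewrite (@inner_reindex id id (@ordS _) (@ord_pred _))//.
by rewrite (@inner_reindex (@ordS _) (@ord_pred _) (@ordS _) (@ord_pred _)).
Qed.

Lemma inner_Dbar_x (dx : R) a b : dx != 0 ->
  inner (Dbar_x dx a) b = - inner a (Dbar_x dx b).
Proof.
move=> dx0.
(* The factorization A^* G_x serves on the right, - G_x^* A on the left; skewness follows since both
   lead to the same corner product. *)
have -> : inner a (Dbar_x dx b) = inner (corner_avg a) (corner_grad_x dx b).
  rewrite inner_corner; apply: eq_innerr => i j.
  rewrite /Dbar_x /corner_grad_x /corner_adj /corner !ord_predK.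
  by field.
rewrite innerC [X in - X]innerC inner_corner -mulN1r -innerZr.
apply: eq_innerr => i j.
rewrite /Dbar_x /corner_avg /corner_adj /corner !ord_predK.
by field.
Qed.

Lemma inner_Dbar_y (dy : R) a b : dy != 0 ->
  inner (Dbar_y dy a) b = - inner a (Dbar_y dy b).
Proof.
move=> dy0.
have -> : inner a (Dbar_y dy b) = inner (corner_avg a) (corner_grad_y dy b).
  rewrite inner_corner; apply: eq_innerr => i j.
  rewrite /Dbar_y /grid_tr /Dbar_x /corner_grad_y /corner_adj /corner !ord_predK.
  by field.
rewrite innerC [X in - X]innerC inner_corner -mulN1r -innerZr.
apply: eq_innerr => i j.
rewrite /Dbar_y /grid_tr /Dbar_x /corner_avg /corner_adj /corner !ord_predK.
by field.
Qed.

Lemma inner_Dbar_xx (dx : R) a b : dx != 0 ->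
  inner a (Dbar_xx dx b) = - inner (corner_grad_x dx a) (corner_grad_x dx b).
Proof.
move=> dx0; rewrite inner_corner -mulN1r -innerZr; apply: eq_innerr => i j.
rewrite /Dbar_xx /corner_grad_x /corner_adj /corner !ord_predK.
by field.
Qed.

Lemma inner_Dbar_yy (dy : R) a b : dy != 0 ->
  inner a (Dbar_yy dy b) = - inner (corner_grad_y dy a) (corner_grad_y dy b).
Proof.
move=> dy0; rewrite inner_corner -mulN1r -innerZr; apply: eq_innerr => i j.
rewrite /Dbar_yy /grid_tr /Dbar_xx /corner_grad_y /corner_adj /corner.
rewrite !ord_predK.
by field.
Qed.

Lemma inner_D_xy (dx dy : R) a b : dx != 0 -> dy != 0 ->
  inner a (D_xy dx dy b) = - inner (corner_grad_x dx a) (corner_grad_y dy b).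
Proof.
move=> dx0 dy0; rewrite inner_corner -mulN1r -innerZr.
apply: eq_innerr => i j.
rewrite /D_xy /corner_grad_y /corner_adj /corner !ord_predK.
by field; apply/andP.
Qed.

(** The corner differences in x and y commute with each other's transposes, so the roles may be
    swapped. With [inner_D_xy], both velocity cross terms then pair G_x u with G_y v. *)
Lemma inner_D_yx (dx dy : R) a b : dx != 0 -> dy != 0 ->
  inner a (D_xy dx dy b) = - inner (corner_grad_y dy a) (corner_grad_x dx b).
Proof.
move=> dx0 dy0; rewrite inner_corner -mulN1r -innerZr.
apply: eq_innerr => i j.
rewrite /D_xy /corner_grad_x /corner_adj /corner !ord_predK.
by field; apply/andP.
Qed.

(** The energy balance at a frozen time: [p'], [u'], [v'] stand for the time derivatives, and each
    equation is tested with its own unknown. *)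
Lemma scheme_dissipation (dx dy c : R) (p u v p' u' v' : grid R Nx Ny) :
  dx != 0 -> dy != 0 -> 0 <= c ->
  (forall i j, p' i j + Dbar_x dx u i j + Dbar_y dy v i j
               = c * (Dbar_xx dx p i j + Dbar_yy dy p i j)) ->
  (forall i j, u' i j + Dbar_x dx p i j
               = c * (Dbar_xx dx u i j + D_xy dx dy v i j)) ->
  (forall i j, v' i j + Dbar_y dy p i j
               = c * (D_xy dx dy u i j + Dbar_yy dy v i j)) ->
  inner u u' + inner v v' + inner p p' <= 0.
Proof.
move=> dx0 dy0 c0 ep eu ev.
have := eq_innerr p _ _ ep.
have := eq_innerr u _ _ eu.
have := eq_innerr v _ _ ev.
rewrite !innerZr !innerDr !inner_Dbar_xx// !inner_Dbar_yy//.
rewrite (inner_D_xy _ _ u)// (inner_D_yx _ _ v)//.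
(* By skewness the pressure and velocity couplings cancel once the three equations are added. *)
have -> : inner p (Dbar_x dx u) = - inner u (Dbar_x dx p).
  by rewrite innerC inner_Dbar_x.
have -> : inner p (Dbar_y dy v) = - inner v (Dbar_y dy p).
  by rewrite innerC inner_Dbar_y.
set gp := corner_grad_x dx p; set hp := corner_grad_y dy p.
set gu := corner_grad_x dx u; set hv := corner_grad_y dy v.
(* The squares are multiplied by [c] beforehand, so that only linear arithmetic remains. *)
have /(mulr_ge0 c0) duv := inner_sqrD_ge0 gu hv.
have /(mulr_ge0 c0) dgp := inner_ge0 gp.
have /(mulr_ge0 c0) dhp := inner_ge0 hp.
rewrite (innerC hv gu); lra.
Qed.

End SummationByParts.

Lemma is_derive_energy {R : realType} {Nx Ny : nat} (p u v : R -> grid R Nx Ny)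
    (t : R) :
  (forall i j, [/\ derivable (fun s => p s i j) t 1,
                   derivable (fun s => u s i j) t 1 &
                   derivable (fun s => v s i j) t 1]) ->
  is_derive t 1
    (fun s => \sum_(i < Nx) \sum_(j < Ny) energy (p s) (u s) (v s) i j)
    (inner (u t) (fun i j => derive1 (fun s => u s i j) t)
     + inner (v t) (fun i j => derive1 (fun s => v s i j) t)
     + inner (p t) (fun i j => derive1 (fun s => p s i j) t)).
Proof.
move=> d.
rewrite /inner -!big_split /=.
(* The function of s becomes a sum of functions, the form that [is_derive_sum] expects. *)
rewrite (_ : (fun s => _) = \sum_(i < Nx) fun s =>
    \sum_(j < Ny) energy (p s) (u s) (v s) i j); last first.
  by apply/funext => s; rewrite fct_sumE.
apply: is_derive_sum => i; rewrite -!big_split /=.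
rewrite (_ : (fun s => _) = \sum_(j < Ny) fun s =>
    energy (p s) (u s) (v s) i j); last first.
  by apply/funext => s; rewrite fct_sumE.
apply: is_derive_sum => j; rewrite /energy.
have [/derivableP dp /derivableP du /derivableP dv] := d i j.
rewrite !derive1E.
(* The derivative is inferred from [dp], [du], [dv]; what remains is that the factors 2 from the
   squares cancel the halves. *)
apply: is_derive_eq.
by rewrite /GRing.scale /=; field.
Qed.

Theorem proposition5 (R : realType) (Nx Ny : nat)
    (hNx : (1 <= Nx)%N) (hNy : (1 <= Ny)%N)
    (dx dy alpha : R) (hdx : 0 < dx) (hdy : 0 < dy) (halpha : 0 < alpha)
    (J : set R) (hJ : open J)
    (p u v : R -> grid R Nx Ny)
    (hsol : is_scheme_solution dx dy alpha J p u v) :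
  let E := fun t : R =>
    \sum_(i < Nx) \sum_(j < Ny) energy (p t) (u t) (v t) i j in
  forall t : R, J t -> derivable E t 1 /\ derive1 E t <= 0.
Proof.
move=> E t Jt; have sol := hsol t Jt.
have dE := is_derive_energy p u v t (fun i j => let: And4 d _ _ _ := sol i j in d).
(* [dE] yields both differentiability and the value of the derivative, so [derive1] is not a junk
   value here. *)
split; first exact: ex_derive.
rewrite derive1E derive_val.
apply: (scheme_dissipation dx dy (alpha * mesh_size dx dy / 2));
  rewrite ?gt_eqF//.
- by rewrite !mulr_ge0 ?invr_ge0 ?sqrtr_ge0// ltW.
- by move=> i j; case: (sol i j).
- by move=> i j; case: (sol i j).
- by move=> i j; case: (sol i j).
Qed.
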